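(* Let $F:[0,\infty)\to[0,\infty)$, $F\in C^1([0,\infty))\cap C^2((0,\infty))$, be a strictly convex function such that $F(0)=F'(0)=0$. Set $$\Lambda(s)=\frac{s\,F''(s)}{F'(s)}\quad\text{for } s>0,$$ and assume that, for some constants $0<\Lambda^-\le\Lambda^+$, it holds that $\Lambda^-\le\Lambda(s)\le\Lambda^+$ for all $s>0$. Let $\Omega\subseteq\mathbb{C}$ be an open set and let $f:\Omega\to\mathbb{C}$ be differentiable in $\Omega$. For $z\in\Omega$ and $r>0$ with $\overline{D_r(z)}\subset\Omega$, let $c^{\mathcal F}(f,r)(z)$ be the minimum point on $\mathbb{C}$ of the function $$\mathcal{F}(c)=\int_{\partial D_r(z)} F\left(\left|f(\zeta)-c\,\overline{(\zeta-z)}\right|\right) dS_\zeta,\quad c\in\mathbb{C}.$$ Then, away from the zeroes of $f$, we have that $c^{\mathcal F}(f,r)=o(1)$ as $r\to0^+$ if and only if $f$ satisfies the equation $$f_{\overline z}+\frac{\Lambda(|f|)-1}{\Lambda(|f|)+1}\,\frac{f}{\overline f}\,\overline f_{\overline z}=0 .$$ That is: $\lim_{r\to0^+}c^{\mathcal F}(f,r)(z)=0$ for every $z\in\Omega$ with $f(z)\neq0$ if and only if the equation holds at every $z\in\Omega$ with $f(z)\ne0$.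
   Context: $D_r(z)$ is the disk in $\mathbb{C}$ centered at $z$ with radius $r$; $dS_\zeta$ is the arc-length element. Differentiability is meant in the real sense (as a map from an open subset of $\mathbb{R}^2$ to $\mathbb{R}^2$). With $z=x+iy$: $2f_{\overline z}=f_x+i f_y$, $2f_z=f_x-i f_y$; $\overline f_{\overline z}$ denotes the $\overline z$-derivative of $\overline f$, i.e. $\overline f_{\overline z}=\overline{f_z}$. Under the stated assumptions $\mathcal F$ has exactly one minimum point on $\mathbb{C}$. *)

(* Defs.v *)
From Stdlib Require Import Reals.
From Coquelicot Require Import Coquelicot.
Open Scope R_scope.

(* Functions [0,oo) -> [0,oo) are total functions R -> R of which only the
   values on [0,oo) are constrained; derivatives and limits at points of
   [0,oo) are taken within [0,oo), hence are one-sided at 0. *)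
Definition nonneg (s : R) : Prop := 0 <= s.

Definition is_derive_nonneg (F : R -> R) (s l : R) : Prop :=
  filterlim (fun y => (F y - F s) / (y - s))
    (within nonneg (locally' s)) (locally l).

Definition C1_nonneg (F : R -> R) : Prop :=
  exists dF : R -> R, forall s : R, 0 <= s ->
    is_derive_nonneg F s (dF s) /\
    filterlim dF (within nonneg (locally s)) (locally (dF s)).

Definition C2_pos (F : R -> R) : Prop :=
  forall s : R, 0 < s ->
    ex_derive F s /\ ex_derive (Derive F) s /\ continuous (Derive_n F 2) s.

Definition strictly_convex_nonneg (F : R -> R) : Prop :=
  forall x y t : R, 0 <= x -> 0 <= y -> x <> y -> 0 < t < 1 ->
    F ((1 - t) * x + t * y) < (1 - t) * F x + t * F y.

Definition Lambda (F : R -> R) (s : R) : R := s * Derive_n F 2 s / Derive F s.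

(* Differentiability over the reals: the scalar ring is R, not C. *)
Definition real_differentiable (f : C -> C) (z : C) : Prop :=
  ex_filterdiff (K := R_AbsRing) (U := C_R_NormedModule)
    (V := C_R_NormedModule) f (locally z).

Definition partial_x (f : C -> C) (z : C) : C :=
  (Derive (fun x => Re (f (x, Im z))) (Re z),
   Derive (fun x => Im (f (x, Im z))) (Re z)).

Definition partial_y (f : C -> C) (z : C) : C :=
  (Derive (fun y => Re (f (Re z, y))) (Im z),
   Derive (fun y => Im (f (Re z, y))) (Im z)).

Definition Dzbar (f : C -> C) (z : C) : C := ((partial_x f z + Ci * partial_y f z) / 2)%C.

(* The integral of g over the circle of centre z and radius r > 0 with respect
   to arc length, in the parametrization zeta = z + r e^(it), dS = r dt. *)
Definition circle_int (g : C -> R) (z : C) (r : R) : R :=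
  RInt (fun t => g (z + r * (cos t, sin t))%C * r) 0 (2 * PI).

Definition calF (F : R -> R) (f : C -> C) (z : C) (r : R) (c : C) : R :=
  circle_int (fun zeta => F (Cmod (f zeta - c * Cconj (zeta - z))%C)) z r.

Definition is_min_point (G : C -> R) (c : C) : Prop :=
  forall c' : C, G c <= G c'.

(* Definite description: this is the minimum point of calF whenever calF has
   exactly one, in particular for F as in the theorem, f continuous on the
   closed disk and r > 0. It carries no information otherwise. *)
Definition cF (F : R -> R) (f : C -> C) (r : R) (z : C) : C :=
  iota (T := C_R_CompleteNormedModule) (is_min_point (calF F f z r)).

(* Main.v *)
Require Import Defs.
From Stdlib Require Import Reals Lra Psatz IndefiniteDescription.
From Coquelicot Require Import Coquelicot.
Open Scope R_scope.

(** The statement holds pointwise, because the minimum points converge for every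
    real differentiable f. Fix z with w = f(z) <> 0, and write
      f(z + h) = w + a h + b conj(h) + o(|h|),
    with a and b the z- and conj(z)-derivatives of f at z. Then, with
    L = Lambda(|w|),
      lim c^F(f, r)(z) = b + (L - 1) / (L + 1) * (w / conj(w)) * conj(a)
    as r -> 0+ ([cF_limit]). The right-hand side is the left-hand side of the
    equation, so the theorem follows from the uniqueness of limits.

    To compute the limit, expand F(|w + v|) to second order in v
    ([radial_taylor]). On the circle, v = r (a e^(it) + (b - c) e^(-it)) + o(r),
    where the error term does not depend on c. In the difference of the functional
    at c and at c0, the contribution of the error to the linear term cancels, the
    terms linear in e^(it) and e^(-it) integrate to 0, and, as dS = r dt, there
    remains r^3 times a quadratic polynomial in c plus o(r^3) ([jet2_perturb],
    [is_RInt_jet2]). That polynomial has leading coefficient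
    2 pi k, where k = F'(|w|) (L + 1) / (4 |w|) > 0 and its critical point c0 is the limit above
    ([jet2_mean_gap]). Hence, on each circle |c - c0| = e, the functional is larger
    than at c0 once r is small ([calF_gap]).

    The functional is strictly convex, since F(|w|) is strictly convex in w
    ([radial_strictly_convex], [calF_strictly_convex]). Therefore it has exactly
    one minimum point, and this lies in the disk |c - c0| < e
    ([strictly_convex_unique_min]); its existence comes from the extreme value
    theorem on a square, which is elementary here because the functional is
    Lipschitz there ([calF_lipschitz]). *)

(** * The function F(|w|): convexity and Lipschitz bounds *)

Lemma convex_increasing (F : R -> R)
  (F_ge0 : forall s, 0 <= s -> 0 <= F s) (F_0 : F 0 = 0)
  (F_convex : strictly_convex_nonneg F) (x y : R) :
  0 <= x -> x < y -> F x < F y.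
Proof.
intros Hx Hxy.
assert (Hy : 0 < F y).
{ pose proof (F_convex 0 y (1/2) ltac:(lra) ltac:(lra) ltac:(lra) ltac:(lra)) as H.
  pose proof (F_ge0 ((1 - 1 / 2) * 0 + 1 / 2 * y) ltac:(lra)). lra. }
destruct (Req_dec x 0) as [->|Hx0]; [lra|].
assert (Ht : 0 < x / y < 1).
{ split; [apply Rdiv_lt_0_compat; lra|]. apply Rlt_div_l; lra. }
pose proof (F_convex 0 y (x/y) ltac:(lra) ltac:(lra) ltac:(lra) Ht) as H.
replace ((1 - x / y) * 0 + x / y * y) with x in H by (field; lra).
nra.
Qed.

(** The slope of a chord inside [0, M] is at most that of the chord from its left
    end to M + 1, on which F increases by at most F (M + 1) over a length >= 1. *)
Lemma convex_lipschitz (F : R -> R)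
  (F_ge0 : forall s, 0 <= s -> 0 <= F s) (F_0 : F 0 = 0)
  (F_convex : strictly_convex_nonneg F) (M x y : R) :
  0 <= x <= M -> 0 <= y <= M -> Rabs (F y - F x) <= F (M + 1) * Rabs (y - x).
Proof.
assert (H : forall x y, 0 <= x -> x < y -> y <= M ->
  Rabs (F y - F x) <= F (M + 1) * Rabs (y - x)).
{ clear x y; intros x y Hx Hxy Hy.
  pose proof (convex_increasing F F_ge0 F_0 F_convex x y Hx Hxy).
  rewrite !Rabs_pos_eq by lra.
  set (t := (y - x) / (M + 1 - x)).
  assert (Ht : 0 < t < 1).
  { unfold t; split; [apply Rdiv_lt_0_compat; lra|]. apply Rlt_div_l; lra. }
  assert (Ht' : t <= y - x).
  { unfold t. apply Rle_div_l; nra. }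
  pose proof (F_convex x (M+1) t Hx ltac:(lra) ltac:(lra) Ht) as Hc.
  replace ((1 - t) * x + t * (M + 1)) with y in Hc by (unfold t; field; lra).
  pose proof (F_ge0 x Hx). pose proof (F_ge0 (M+1) ltac:(lra)). nra. }
intros Hx Hy. destruct (Rtotal_order x y) as [Hl|[<-|Hl]].
- apply H; lra.
- rewrite !Rminus_diag, Rabs_R0; lra.
- rewrite (Rabs_minus_sym (F y)), (Rabs_minus_sym y). apply H; lra.
Qed.

(** The radial function w |-> F(|w|) on the plane. *)
Definition radial (F : R -> R) (w : C) : R := F (Cmod w).

Lemma Cmod_dist (w w' : C) : Rabs (Cmod w - Cmod w') <= Cmod (w - w')%C.
Proof.
apply Rabs_le; split.
- pose proof (Cmod_triangle w (w' - w)) as H.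
  replace (w + (w' - w))%C with w' in H by ring.
  rewrite <- (Cmod_opp (w' - w)) in H.
  replace (- (w' - w))%C with (w - w')%C in H by ring. lra.
- pose proof (Cmod_triangle w' (w - w')) as H.
  replace (w' + (w - w'))%C with w in H by ring. lra.
Qed.

Lemma radial_lipschitz (F : R -> R)
  (F_ge0 : forall s, 0 <= s -> 0 <= F s) (F_0 : F 0 = 0)
  (F_convex : strictly_convex_nonneg F) (M : R) (w w' : C) :
  Cmod w <= M -> Cmod w' <= M ->
  Rabs (radial F w - radial F w') <= F (M + 1) * Cmod (w - w')%C.
Proof.
intros Hw Hw'. pose proof (Cmod_ge_0 w). pose proof (Cmod_ge_0 w').
eapply Rle_trans; [apply (convex_lipschitz F F_ge0 F_0 F_convex M); lra|].
apply Rmult_le_compat_l; [apply F_ge0; lra| apply Cmod_dist].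
Qed.

Lemma Cmod_sqr (w : C) : Cmod w ^ 2 = fst w ^ 2 + snd w ^ 2.
Proof. rewrite Cmod2_alt; reflexivity. Qed.

(** If |w| <> |w'| the strict convexity of F gives the strict inequality; if
    |w| = |w'| the strict convexity of the disk does, F being increasing. *)
Lemma radial_strictly_convex (F : R -> R)
  (F_ge0 : forall s, 0 <= s -> 0 <= F s) (F_0 : F 0 = 0)
  (F_convex : strictly_convex_nonneg F) (w w' : C) (t : R) :
  w <> w' -> 0 < t < 1 ->
  radial F ((1 - t) * w + t * w')%C < (1 - t) * radial F w + t * radial F w'.
Proof.
intros Hne Ht. unfold radial.
pose proof (Cmod_ge_0 w) as P. pose proof (Cmod_ge_0 w') as P'.
set (m := Cmod ((1 - t) * w + t * w')%C).
assert (Pm : 0 <= m) by apply Cmod_ge_0.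
assert (Hm2 : m ^ 2 = (1 - t) * Cmod w ^ 2 + t * Cmod w' ^ 2
                      - t * (1 - t) * Cmod (w - w')%C ^ 2).
{ unfold m. rewrite !Cmod_sqr. destruct w, w'; simpl. ring. }
assert (Hd : 0 < Cmod (w - w')%C).
{ apply Cmod_gt_0. intros H. apply Hne.
  replace w with ((w - w') + w')%C by ring. rewrite H; ring. }
assert (Hdd : Rabs (Cmod w - Cmod w') <= Cmod (w - w')%C) by apply Cmod_dist.
assert (Hdd2 : (Cmod w - Cmod w') ^ 2 <= Cmod (w - w')%C ^ 2).
{ apply pow_maj_Rabs; exact Hdd. }
set (d := Cmod (w - w')%C) in *. set (a := Cmod w) in *. set (b := Cmod w') in *.
assert (Hle : m <= (1 - t) * a + t * b).
{ apply Rsqr_incr_0; [unfold Rsqr|lra|nra].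
  assert (0 < t * (1 - t)) by nra. nra. }
destruct (Req_dec a b) as [Hab|Hab].
- assert (m < a).
  { apply Rsqr_incrst_0; [unfold Rsqr|lra|lra]. rewrite <- Hab in Hm2.
    assert (0 < t * (1 - t)) by nra. assert (0 < d ^ 2) by nra. nra. }
  rewrite <- Hab.
  pose proof (convex_increasing F F_ge0 F_0 F_convex m a Pm H). lra.
- pose proof (F_convex a b t P P' Hab Ht) as H.
  destruct (Req_dec m ((1 - t) * a + t * b)) as [Hm|Hm].
  + rewrite <- Hm in H. exact H.
  + assert (Hlt : m < (1 - t) * a + t * b) by lra.
    pose proof (convex_increasing F F_ge0 F_0 F_convex m _ Pm Hlt). lra.
Qed.

(** The balls of the uniform structure on C are squares; the next two lemmas
    compare them with disks. *)
Lemma ball_C (z w : C) (e : R) : Cmod (w - z)%C < e -> @ball C_UniformSpace z e w.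
Proof. intros H. apply C_NormedModule_mixin_compat1. exact H. Qed.

Lemma ball_C_Cmod (z w : C) (e : posreal) :
  @ball C_UniformSpace z e w -> Cmod (w - z)%C < 2 * e.
Proof.
intros H. apply C_NormedModule_mixin_compat2 in H.
eapply Rlt_le_trans; [exact H|].
apply Rmult_le_compat_r; [apply Rlt_le, cond_pos|].
rewrite <- (sqrt_square 2) at 2 by lra. apply sqrt_le_1; lra.
Qed.

Lemma radial_continuous (F : R -> R)
  (F_ge0 : forall s, 0 <= s -> 0 <= F s) (F_0 : F 0 = 0)
  (F_convex : strictly_convex_nonneg F) (w : C) :
  continuous (T := C_UniformSpace) (U := R_UniformSpace) (radial F) w.
Proof.
intros P [e HP].
set (K := F (Cmod w + 1 + 1)).
assert (HK : 0 <= K) by (apply F_ge0; pose proof (Cmod_ge_0 w); lra).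
assert (Hd : 0 < Rmin (1/2) (e / (2 * (K + 1)))).
{ apply Rmin_pos; [lra|]. apply Rdiv_lt_0_compat; [apply cond_pos|lra]. }
exists (mkposreal _ Hd). intros w' Hw'. apply HP.
apply ball_C_Cmod in Hw'. simpl in Hw'.
set (d := Rmin (1/2) (e / (2 * (K + 1)))) in *.
assert (d <= 1/2) by apply Rmin_l.
assert (d <= e / (2 * (K + 1))) by apply Rmin_r.
pose proof (Cmod_dist w' w) as Hcd.
apply Rabs_le_between in Hcd.
pose proof (radial_lipschitz F F_ge0 F_0 F_convex (Cmod w + 1) w' w
  ltac:(lra) ltac:(lra)) as H1.
fold K in H1.
change (Rabs (radial F w' - radial F w) < e).
eapply Rle_lt_trans; [exact H1|].
assert (K * Cmod (w' - w)%C <= K * (2 * (e / (2 * (K + 1))))).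
{ apply Rmult_le_compat_l; lra. }
eapply Rle_lt_trans; [exact H2|].
replace (K * (2 * (e / (2 * (K + 1))))) with (e * K / (K + 1)) by (field; lra).
apply Rlt_div_l; [lra|]. pose proof (cond_pos e). nra.
Qed.

(** * Second-order expansion of F(|w|) *)

(** Second-order Taylor expansion with Peano remainder. *)
Lemma taylor2_peano (g g' : R -> R) (x l : R) :
  locally x (fun y => is_derive g y (g' y)) -> is_derive g' x l ->
  forall eta, 0 < eta -> exists d, 0 < d /\ forall k, Rabs k < d ->
    Rabs (g (x + k) - g x - g' x * k - l / 2 * k ^ 2) <= eta * k ^ 2.
Proof.
intros [d1 H1] H2 eta Heta.
apply is_derive_Reals in H2. destruct (H2 eta Heta) as [d2 Hd2].
exists (Rmin d1 d2). split; [apply Rmin_pos; apply cond_pos|].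
intros k Hk.
assert (Hk1 : Rabs k < d1) by (eapply Rlt_le_trans; [exact Hk|apply Rmin_l]).
assert (Hk2 : Rabs k < d2) by (eapply Rlt_le_trans; [exact Hk|apply Rmin_r]).
assert (D : forall h, Rabs h <= Rabs k ->
  is_derive (fun h => g (x + h) - g x - g' x * h - l / 2 * h ^ 2) h
    (g' (x + h) - g' x - l * h)).
{ intros h Hh. specialize (H1 (x + h)).
  assert (Hb : ball x d1 (x + h)).
  { change (Rabs (x + h - x) < d1). replace (x + h - x) with h by ring. lra. }
  specialize (H1 Hb). auto_derive.
  - exists (g' (x + h)). exact H1.
  - replace (Derive (fun x0 : R => g x0) (x + h)) with (g' (x + h))
      by (symmetry; apply is_derive_unique; exact H1). field. }
destruct (MVT_gen (fun h => g (x + h) - g x - g' x * h - l / 2 * h ^ 2) 0 k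
  (fun h => g' (x + h) - g' x - l * h)) as [c [Hc Hv]].
{ intros h Hh. apply D. unfold Rmin, Rmax in Hh.
  destruct (Rle_dec 0 k); unfold Rabs; destruct (Rcase_abs h), (Rcase_abs k); lra. }
{ intros h Hh. apply continuity_pt_filterlim.
  apply (ex_derive_continuous (V := R_NormedModule)
    (fun h => g (x + h) - g x - g' x * h - l / 2 * h ^ 2)).
  eexists. apply D. unfold Rmin, Rmax in Hh.
  destruct (Rle_dec 0 k); unfold Rabs; destruct (Rcase_abs h), (Rcase_abs k); lra. }
assert (Hck : Rabs c <= Rabs k).
{ unfold Rmin, Rmax in Hc.
  destruct (Rle_dec 0 k); unfold Rabs; destruct (Rcase_abs c), (Rcase_abs k); lra. }
assert (Hs : Rabs (g' (x + c) - g' x - l * c) <= eta * Rabs c).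
{ destruct (Req_dec c 0) as [->|Hc0].
  - rewrite Rplus_0_r, Rmult_0_r, Rminus_diag, Rminus_0_r, Rabs_R0; lra.
  - replace (g' (x + c) - g' x - l * c) with (((g' (x + c) - g' x) / c - l) * c)
      by (field; lra).
    rewrite Rabs_mult. apply Rmult_le_compat_r; [apply Rabs_pos|].
    apply Rlt_le, Hd2; lra. }
replace (g (x + k) - g x - g' x * k - l / 2 * k ^ 2)
  with ((g' (x + c) - g' x - l * c) * (k - 0)).
2:{ rewrite <- Hv. rewrite Rplus_0_r. ring. }
rewrite Rminus_0_r, Rabs_mult, <- (pow2_abs k).
pose proof (Rabs_pos k).
replace (eta * Rabs k ^ 2) with (eta * Rabs k * Rabs k) by ring.
apply Rmult_le_compat_r; [lra|]. eapply Rle_trans; [exact Hs|].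
apply Rmult_le_compat_l; lra.
Qed.

(** F lies below its chord over [0, s], whence F'(s) >= F(s) / s > 0. *)
Lemma Derive_convex_pos (F : R -> R)
  (F_ge0 : forall s, 0 <= s -> 0 <= F s) (F_0 : F 0 = 0)
  (F_convex : strictly_convex_nonneg F) (s : R) :
  0 < s -> ex_derive F s -> 0 < Derive F s.
Proof.
intros Hs Hd.
assert (HFs : 0 < F s / s).
{ apply Rdiv_lt_0_compat; [|lra]. rewrite <- F_0.
  apply convex_increasing; auto; lra. }
destruct (Rlt_le_dec 0 (Derive F s)) as [H|H]; [exact H|exfalso].
apply Derive_correct in Hd. apply is_derive_Reals in Hd.
destruct (Hd (F s / s) HFs) as [d Hdd].
set (h := Rmin (d / 2) (s / 2)).
assert (Hh : 0 < h) by (apply Rmin_pos; [pose proof (cond_pos d)|]; lra).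
assert (Hh1 : h <= d / 2) by apply Rmin_l.
assert (Hh2 : h <= s / 2) by apply Rmin_r.
specialize (Hdd (- h) ltac:(lra)). rewrite Rabs_Ropp, Rabs_pos_eq in Hdd by lra.
specialize (Hdd ltac:(pose proof (cond_pos d); lra)).
apply Rabs_lt_between in Hdd.
(* the chord of F over [0, s] lies above the graph at s - h *)
pose proof (F_convex 0 s ((s - h) / s) ltac:(lra) ltac:(lra) ltac:(lra)
  ltac:(split; [apply Rdiv_lt_0_compat; lra|apply Rlt_div_l; lra])) as Hc.
replace ((1 - (s - h) / s) * 0 + (s - h) / s * s) with (s + - h) in Hc by (field; lra).
rewrite F_0 in Hc.
assert ((F (s + - h) - F s) / - h > F s / s); [|lra].
replace ((F (s + - h) - F s) / - h) with ((F s - F (s + - h)) / h) by (field; lra).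
apply Rlt_gt, (proj1 (Rlt_div_r _ _ h Hh)).
replace ((1 - (s - h) / s) * 0 + (s - h) / s * F s) with (F s - F s / s * h) in Hc
  by (field; lra). lra.
Qed.

(** The scalar product of the plane. *)
Definition Cdot (v w : C) : R := fst v * fst w + snd v * snd w.

Lemma Rabs_Cdot_le (v w : C) : Rabs (Cdot v w) <= Cmod v * Cmod w.
Proof.
rewrite <- (Rabs_pos_eq (Cmod v * Cmod w))
  by (apply Rmult_le_pos; apply Cmod_ge_0).
apply Rsqr_le_abs_0. unfold Rsqr.
replace (Cmod v * Cmod w * (Cmod v * Cmod w)) with (Cmod v ^ 2 * Cmod w ^ 2) by ring.
rewrite !Cmod_sqr. unfold Cdot.
pose proof (pow2_ge_0 (fst v * snd w - snd v * fst w)). nra.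
Qed.

(** The first- and second-order terms at w of a function g(|w|^2), where g1 and
    g2 are g' and g'' at |w|^2: the increment of |w|^2 along v is exactly
    2 w.v + |v|^2. *)
Definition jet2 (g1 g2 : R) (w v : C) : R :=
  g1 * (2 * Cdot w v + Cmod v ^ 2)
  + 2 * g2 * Cdot w v ^ 2.

(** F(|w|) = g(|w|^2) with g(q) = F(sqrt q), so the expansion of F(|w + v|) is
    that of g at |w|^2; g1 and g2 below are g' and g'' at |w|^2. *)
Lemma radial_taylor (F : R -> R) (F_C2 : C2_pos F) (w : C) :
  w <> 0%C ->
  let s := Cmod w in
  let g1 := Derive F s / (2 * s) in
  let g2 := (Derive_n F 2 s - Derive F s / s) / (4 * s ^ 2) in
  forall eta, 0 < eta -> exists d, 0 < d /\ forall v : C, Cmod v < d ->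
    Rabs (radial F (w + v)%C - radial F w - jet2 g1 g2 w v) <= eta * Cmod v ^ 2.
Proof.
intros Hw s g1 g2 eta Heta.
assert (Hs : 0 < s) by (apply Cmod_gt_0, Hw).
assert (Hs2 : 0 < s ^ 2) by nra.
set (g := fun q => F (sqrt q)).
set (g' := fun q => Derive F (sqrt q) / (2 * sqrt q)).
assert (Hsq : sqrt (s ^ 2) = s) by (apply sqrt_pow2; lra).
assert (G1 : locally (s ^ 2) (fun y => is_derive g y (g' y))).
{ exists (mkposreal _ Hs2). intros y Hy.
  assert (Hy0 : 0 < y).
  { change (Rabs (y - s ^ 2) < s ^ 2) in Hy. apply Rabs_lt_between in Hy. lra. }
  pose proof (sqrt_lt_R0 y Hy0).
  destruct (F_C2 (sqrt y) H) as [E _].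
  unfold g, g'. auto_derive; [repeat split; auto|].
  change (fun x : R => F x) with F. field; lra. }
assert (G2 : is_derive g' (s ^ 2) (2 * (g2 / 2))).
{ destruct (F_C2 s Hs) as [_ [E _]].
  unfold g', g2. change (Derive_n F 2 s) with (Derive (Derive F) s).
  set (F' := Derive F) in *. auto_derive; rewrite ?Rmult_1_r.
  - replace (s * s) with (s ^ 2) by ring. rewrite Hsq.
    repeat split; auto; lra.
  - replace (s * s) with (s ^ 2) by ring. rewrite Hsq.
    change (fun x : R => F' x) with F'. field; lra. }
set (N := 2 * s + 1).
assert (HN : 1 < N) by (unfold N; lra).
destruct (taylor2_peano g g' (s ^ 2) _ G1 G2 (eta / (2 * N ^ 2))) as [d [Hd HT]].
{ apply Rdiv_lt_0_compat; nra. }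
set (K := Rabs g2 * N).
assert (HK : 0 <= K) by (unfold K; pose proof (Rabs_pos g2); nra).
exists (Rmin (1/2) (Rmin (d / N) (eta / (2 * (K + 1))))).
split.
{ repeat apply Rmin_pos; try lra; apply Rdiv_lt_0_compat; lra. }
intros v Hv.
assert (Hv1 : Cmod v < 1/2) by (eapply Rlt_le_trans; [exact Hv|apply Rmin_l]).
assert (Hv2 : Cmod v < d / N).
{ eapply Rlt_le_trans; [exact Hv|]. eapply Rle_trans; [apply Rmin_r|apply Rmin_l]. }
assert (Hv3 : Cmod v < eta / (2 * (K + 1))).
{ eapply Rlt_le_trans; [exact Hv|]. eapply Rle_trans; [apply Rmin_r|apply Rmin_r]. }
pose proof (Cmod_ge_0 v) as Hv0.
set (p := Cdot w v).
set (m := Cmod v) in *.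
assert (Hp : Rabs p <= s * m) by apply Rabs_Cdot_le.
apply Rabs_le_between in Hp.
set (k := 2 * p + m ^ 2).
assert (Hk : Rabs k <= N * m).
{ unfold k, N. apply Rabs_le; split; nra. }
assert (Hkd : Rabs k < d).
{ apply Rlt_div_r in Hv2; [|lra]. lra. }
specialize (HT k Hkd).
assert (Hk2 : k ^ 2 <= N ^ 2 * m ^ 2).
{ rewrite <- pow2_abs. replace (N ^ 2 * m ^ 2) with ((N * m) ^ 2) by ring.
  apply pow_incr. split; [apply Rabs_pos|exact Hk]. }
assert (Egw : radial F w = g (s ^ 2)) by (unfold g; rewrite Hsq; reflexivity).
assert (Egv : radial F (w + v)%C = g (s ^ 2 + k)).
{ unfold g, radial. f_equal. symmetry.
  rewrite <- (sqrt_pow2 (Cmod (w + v)%C)) by apply Cmod_ge_0. f_equal.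
  unfold k, s, m, p, Cdot. rewrite !Cmod_sqr. destruct w, v; simpl. ring. }
assert (Eg1 : g' (s ^ 2) = g1) by (unfold g', g1; rewrite Hsq; reflexivity).
rewrite Eg1 in HT. rewrite <- Egv, <- Egw in HT.
replace (2 * (g2 / 2) / 2) with (g2 / 2) in HT by field.
(* k ^ 2 and (2 p) ^ 2 differ by a cubic term *)
assert (Hc : Rabs (g2 / 2 * k ^ 2 - 2 * g2 * p ^ 2) <= eta / 2 * m ^ 2).
{ replace (g2 / 2 * k ^ 2 - 2 * g2 * p ^ 2)
    with (g2 * (m ^ 2 * (2 * p + m ^ 2 / 2))) by (unfold k; field).
  rewrite Rabs_mult.
  assert (Rabs (m ^ 2 * (2 * p + m ^ 2 / 2)) <= m ^ 2 * (N * m)).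
  { rewrite Rabs_mult, (Rabs_pos_eq (m ^ 2)) by nra.
    apply Rmult_le_compat_l; [nra|]. apply Rabs_le; unfold N; split; nra. }
  apply Rle_trans with (Rabs g2 * (m ^ 2 * (N * m))).
  { apply Rmult_le_compat_l; [apply Rabs_pos|exact H]. }
  replace (Rabs g2 * (m ^ 2 * (N * m))) with (m ^ 2 * (K * m)) by (unfold K; ring).
  assert (K * m <= eta / 2).
  { apply Rlt_div_r in Hv3; [|lra]. nra. }
  assert (0 <= m ^ 2) by nra. nra. }
assert (HT' : eta / (2 * N ^ 2) * k ^ 2 <= eta / 2 * m ^ 2).
{ replace (eta / 2 * m ^ 2) with (eta / (2 * N ^ 2) * (N ^ 2 * m ^ 2)) by (field; lra).
  apply Rmult_le_compat_l; [|exact Hk2].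
  apply Rlt_le, Rdiv_lt_0_compat; nra. }
apply Rabs_le_between in Hc. apply Rabs_le_between in HT.
unfold jet2. fold m. fold p. fold k. apply Rabs_le. lra.
Qed.

(** * Minimum points of strictly convex functions on the plane *)

Lemma Rabs_fst_le (w : C) : Rabs (fst w) <= Cmod w.
Proof. eapply Rle_trans; [apply Rmax_l|apply Rmax_Cmod]. Qed.

Lemma Rabs_snd_le (w : C) : Rabs (snd w) <= Cmod w.
Proof. eapply Rle_trans; [apply Rmax_r|apply Rmax_Cmod]. Qed.

Lemma Cmod_le_Rabs (w : C) : Cmod w <= Rabs (fst w) + Rabs (snd w).
Proof.
pose proof (Rabs_pos (fst w)). pose proof (Rabs_pos (snd w)).
apply Rsqr_incr_0; [|apply Cmod_ge_0|lra]. unfold Rsqr.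
pose proof (Cmod_sqr w) as E. rewrite <- (pow2_abs (fst w)), <- (pow2_abs (snd w)) in E.
nra.
Qed.

(** The closed square with centre a and side 2 e. *)
Definition in_square (a : C) (e : R) (c : C) : Prop :=
  Rabs (fst c - fst a) <= e /\ Rabs (snd c - snd a) <= e.

Lemma lipschitz_interval_min (g : R -> R) (a b K : R) :
  a <= b ->
  (forall x y, a <= x <= b -> a <= y <= b -> Rabs (g x - g y) <= K * Rabs (x - y)) ->
  exists m, a <= m <= b /\ forall x, a <= x <= b -> g m <= g x.
Proof.
intros Hab HK.
(* g precomposed with the retraction onto [a, b] is continuous everywhere *)
set (pr := fun x => Rmax a (Rmin b x)).
assert (Hpr : forall x, a <= pr x <= b).
{ intros x; unfold pr, Rmax, Rmin; destruct (Rle_dec b x);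
    destruct Rle_dec; lra. }
assert (Hid : forall x, a <= x <= b -> pr x = x).
{ intros x Hx; unfold pr, Rmax, Rmin; destruct (Rle_dec b x);
    destruct Rle_dec; lra. }
assert (H1 : forall x y, Rabs (pr x - pr y) <= Rabs (x - y)).
{ intros x y; unfold pr, Rmax, Rmin, Rabs; destruct (Rle_dec b x), (Rle_dec b y);
    repeat (destruct Rle_dec); repeat (destruct Rcase_abs); lra. }
destruct (continuity_ab_min (fun x => g (pr x)) a b Hab) as [m [Hm Hmab]].
{ intros x _ e He. exists (e / (Rabs K + 1)). pose proof (Rabs_pos K).
  split; [apply Rdiv_lt_0_compat; lra|].
  intros y [_ Hy]. simpl in *. unfold Rdist in *.
  eapply Rle_lt_trans; [apply HK; apply Hpr|].
  apply Rle_lt_trans with ((Rabs K + 1) * Rabs (y - x)).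
  - pose proof (Rabs_pos (pr y - pr x)). pose proof (H1 y x). pose proof (Rle_abs K). nra.
  - apply (proj2 (Rlt_div_r _ _ (Rabs K + 1) ltac:(lra))) in Hy. lra. }
exists m. split; [exact Hmab|]. intros x Hx.
specialize (Hm x Hx). simpl in Hm. rewrite !Hid in Hm by assumption. exact Hm.
Qed.

(** For each y, minimize over x first; the partial minimum is a Lipschitz function
    of y. *)
Lemma lipschitz_square_min (G : C -> R) (a : C) (e K : R) :
  0 <= e ->
  (forall c c', in_square a e c -> in_square a e c' ->
     Rabs (G c - G c') <= K * Cmod (c - c')%C) ->
  exists m, in_square a e m /\ forall c, in_square a e c -> G m <= G c.
Proof.
intros He HK.
assert (Hsq : forall x y, fst a - e <= x <= fst a + e -> snd a - e <= y <= snd a + e ->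
  in_square a e (x, y)).
{ intros x y Hx Hy. split; simpl; apply Rabs_le; lra. }
assert (Hsq' : forall c, in_square a e c ->
   fst a - e <= fst c <= fst a + e /\ snd a - e <= snd c <= snd a + e).
{ intros c [H1 H2]. apply Rabs_le_between in H1. apply Rabs_le_between in H2. lra. }
assert (Hx : forall y, exists x, snd a - e <= y <= snd a + e ->
  fst a - e <= x <= fst a + e /\
  forall x', fst a - e <= x' <= fst a + e -> G (x, y) <= G (x', y)).
{ intros y.
  destruct (Rle_dec (snd a - e) y) as [H1|H1]; [|exists 0; lra].
  destruct (Rle_dec y (snd a + e)) as [H2|H2]; [|exists 0; lra].
  destruct (lipschitz_interval_min (fun x => G (x, y)) (fst a - e) (fst a + e) K)
    as [x Hx]; [lra| |exists x; intros _; exact Hx].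
  intros x x' Hx Hx'. eapply Rle_trans; [apply HK; apply Hsq; lra|].
  right. f_equal. unfold Cmod; simpl.
  rewrite <- sqrt_Rsqr_abs; f_equal; unfold Rsqr; ring. }
destruct (functional_choice _ Hx) as [X HX].
destruct (lipschitz_interval_min (fun y => G (X y, y)) (snd a - e) (snd a + e) K)
  as [m [Hm HmG]]; [lra| |].
{ assert (Hone : forall y y', snd a - e <= y <= snd a + e ->
    snd a - e <= y' <= snd a + e -> G (X y, y) - G (X y', y') <= K * Rabs (y - y')).
  { intros y y' Hy Hy'. destruct (HX y Hy) as [_ H]. destruct (HX y' Hy') as [H' _].
    specialize (H (X y') H').
    assert (HL : Rabs (G (X y', y) - G (X y', y')) <= K * Rabs (y - y')).
    { eapply Rle_trans; [apply HK; apply Hsq; lra|].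
      right. f_equal. unfold Cmod; simpl.
      rewrite <- sqrt_Rsqr_abs; f_equal; unfold Rsqr; ring. }
    apply Rabs_le_between in HL. lra. }
  intros y y' Hy Hy'. apply Rabs_le. pose proof (Hone y y' Hy Hy').
  pose proof (Hone y' y Hy' Hy). rewrite (Rabs_minus_sym y' y) in H0. lra. }
destruct (HX m Hm) as [HXm Hmin].
exists (X m, m). split; [apply Hsq; lra|].
intros [x y] Hc. apply Hsq' in Hc. simpl in Hc.
destruct (HX y ltac:(lra)) as [_ Hy].
specialize (HmG y ltac:(lra)). specialize (Hy x ltac:(lra)). lra.
Qed.

(** By convexity the inequality on the circle |c - a| = e persists outside of it,
    so that a minimum over the circumscribed square is global. *)
Lemma strictly_convex_unique_min (G : C -> R) (a : C) (e K : R) :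
  0 < e ->
  (forall c c' t, c <> c' -> 0 < t < 1 ->
     G ((1 - t) * c + t * c')%C < (1 - t) * G c + t * G c') ->
  (forall c c', in_square a e c -> in_square a e c' ->
     Rabs (G c - G c') <= K * Cmod (c - c')%C) ->
  (forall c, Cmod (c - a)%C = e -> G a < G c) ->
  exists c, Cmod (c - a)%C < e /\ is_min_point G c /\
    forall c', is_min_point G c' -> c' = c.
Proof.
intros He Hconv Hlip Hcirc.
assert (Hout : forall c, e <= Cmod (c - a)%C -> G a < G c).
{ intros c [Hc|Hc]; [|apply Hcirc; auto].
  (* the segment from a to c meets the circle at parameter t *)
  set (t := e / Cmod (c - a)%C).
  assert (Ht : 0 < t < 1).
  { unfold t; split; [apply Rdiv_lt_0_compat; lra|apply Rlt_div_l; lra]. }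
  assert (Hac : a <> c).
  { intros ->. replace (c - c)%C with (RtoC 0) in Hc by ring. rewrite Cmod_0 in Hc. lra. }
  pose proof (Hconv a c t Hac Ht) as H.
  assert (Hp : G a < G ((1 - t) * a + t * c)%C).
  { apply Hcirc. replace ((1 - t) * a + t * c - a)%C with (t * (c - a))%C by ring.
    rewrite Cmod_mult, Cmod_R, Rabs_pos_eq by lra. unfold t. field; lra. }
  nra. }
destruct (lipschitz_square_min G a e K ltac:(lra) Hlip) as [m [Hm Hmin]].
assert (Ha : G m <= G a).
{ apply Hmin. split; rewrite Rminus_diag, Rabs_R0; lra. }
assert (Hglob : is_min_point G m).
{ intros c. destruct (Rlt_le_dec (Cmod (c - a)%C) e) as [H|H].
  - apply Hmin. split.
    + apply Rle_trans with (Cmod (c - a)%C); [|lra]. apply (Rabs_fst_le (c - a)%C).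
    + apply Rle_trans with (Cmod (c - a)%C); [|lra]. apply (Rabs_snd_le (c - a)%C).
  - specialize (Hout c H). lra. }
exists m. split; [|split; [exact Hglob|]].
- destruct (Rlt_le_dec (Cmod (m - a)%C) e) as [H|H]; [exact H|].
  specialize (Hout m H). lra.
- intros c Hc. destruct (Ceq_dec c m) as [E|E]; [exact E|exfalso].
  pose proof (Hconv c m (1/2) E ltac:(lra)) as H.
  pose proof (Hglob ((1 - (1/2)%R) * c + (1/2)%R * m)%C).
  specialize (Hc m). lra.
Qed.

(** * Continuity, convexity and Lipschitz bounds of the functional *)

Lemma continuous_Cpair (a b : R -> R) (t : R) :
  continuous a t -> continuous b t ->
  continuous (T := R_UniformSpace) (U := C_UniformSpace) (fun t => (a t, b t)) t.
Proof.
intros Ha Hb P [e HP].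
assert (Ha' := proj1 (filterlim_locally a (a t)) Ha e).
assert (Hb' := proj1 (filterlim_locally b (b t)) Hb e).
unfold filtermap. generalize (filter_and _ _ Ha' Hb'). apply filter_imp.
intros x [H1 H2]. apply HP. split; assumption.
Qed.

(** The point z + r e^(it). *)
Definition circle_point (z : C) (r t : R) : C := (z + r * (cos t, sin t))%C.

Lemma continuous_cos_sin (a b d t : R) : continuous (fun t => d + a * cos t + b * sin t) t.
Proof.
apply (ex_derive_continuous (V := R_NormedModule)
  (fun t => d + a * cos t + b * sin t)). auto_derive; trivial.
Qed.

Lemma circle_point_continuous (z : C) (r t : R) :
  continuous (T := R_UniformSpace) (U := C_UniformSpace) (circle_point z r) t.
Proof.
apply (continuous_ext (fun t => (fst z + r * cos t + 0 * sin t, snd z + 0 * cos t + r * sin t))).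
{ intros x. unfold circle_point. apply injective_projections; simpl; ring. }
apply continuous_Cpair; apply continuous_cos_sin.
Qed.

(** The integrand of calF in the angular variable t, including the factor r of
    the arc length. *)
Definition circle_integrand (F : R -> R) (f : C -> C) (z : C) (r : R) (c : C) (t : R) : R :=
  radial F (f (circle_point z r t) - c * Cconj (circle_point z r t - z))%C * r.

Lemma circle_integrand_continuous (F : R -> R)
  (F_ge0 : forall s, 0 <= s -> 0 <= F s) (F_0 : F 0 = 0)
  (F_convex : strictly_convex_nonneg F) (f : C -> C) (z c : C) (r t : R) :
  (forall t, continuous (T := C_UniformSpace) (U := C_UniformSpace) f (circle_point z r t)) ->
  continuous (circle_integrand F f z r c) t.
Proof.
intros Hf.
apply (continuous_mult (fun t => radial F (f (circle_point z r t)
     - c * Cconj (circle_point z r t - z))%C) (fun _ => r)); [|apply continuous_const].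
apply (continuous_comp (U := R_UniformSpace) (V := C_UniformSpace) (W := R_UniformSpace)
  (fun t => f (circle_point z r t) - c * Cconj (circle_point z r t - z))%C (radial F));
  [|apply radial_continuous; assumption].
apply (continuous_minus (V := C_R_NormedModule) (fun t => f (circle_point z r t))
  (fun t => c * Cconj (circle_point z r t - z))%C).
- apply (continuous_comp (U := R_UniformSpace) (V := C_UniformSpace) (W := C_UniformSpace));
    [apply circle_point_continuous|apply Hf].
- apply (continuous_ext (U := C_UniformSpace)
    (fun t => (0 + fst c * r * cos t + snd c * r * sin t,
               0 + snd c * r * cos t + (- fst c * r) * sin t))).
  { intros x. unfold circle_point. apply injective_projections; simpl; ring. }
  apply continuous_Cpair; apply continuous_cos_sin.
Qed.

Lemma ex_RInt_cont (g : R -> R) (a b : R) :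
  (forall t, continuous g t) -> ex_RInt g a b.
Proof. intros H. apply (ex_RInt_continuous (V := R_CompleteNormedModule)). intros; apply H. Qed.

Lemma calF_minus (F : R -> R)
  (F_ge0 : forall s, 0 <= s -> 0 <= F s) (F_0 : F 0 = 0)
  (F_convex : strictly_convex_nonneg F) (f : C -> C) (z : C) (r : R) (c c' : C) :
  (forall t, continuous (T := C_UniformSpace) (U := C_UniformSpace) f (circle_point z r t)) ->
  calF F f z r c - calF F f z r c'
  = RInt (fun t => circle_integrand F f z r c t - circle_integrand F f z r c' t) 0 (2 * PI).
Proof.
intros Hf. symmetry. apply is_RInt_unique.
apply (is_RInt_minus (V := R_NormedModule));
  apply (RInt_correct (V := R_CompleteNormedModule)); apply ex_RInt_cont;
  intros t; apply circle_integrand_continuous; assumption.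
Qed.

Lemma circle_point_conj (z : C) (r t : R) :
  Cconj (circle_point z r t - z) = (r * (cos t, (- sin t)%R))%C.
Proof. unfold circle_point; apply injective_projections; simpl; ring. Qed.

Lemma Cmod_cos_sin (t : R) : Cmod (cos t, sin t) = 1.
Proof.
pose proof (sin2_cos2 t) as H. unfold Rsqr in H.
transitivity (sqrt 1); [unfold Cmod; simpl; f_equal; lra|apply sqrt_1].
Qed.

Lemma Cmod_cos_sin_conj (t : R) : Cmod (cos t, - sin t) = 1.
Proof.
pose proof (sin2_cos2 t) as H. unfold Rsqr in H.
transitivity (sqrt 1); [unfold Cmod; simpl; f_equal; lra|apply sqrt_1].
Qed.

Lemma calF_strictly_convex (F : R -> R)
  (F_ge0 : forall s, 0 <= s -> 0 <= F s) (F_0 : F 0 = 0)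
  (F_convex : strictly_convex_nonneg F) (f : C -> C) (z : C) (r : R) :
  (forall t, continuous (T := C_UniformSpace) (U := C_UniformSpace) f (circle_point z r t)) ->
  0 < r -> forall c c' t, c <> c' -> 0 < t < 1 ->
  calF F f z r ((1 - t) * c + t * c')%C < (1 - t) * calF F f z r c + t * calF F f z r c'.
Proof.
intros Hf Hr c c' t Hne Ht.
set (h := circle_integrand F f z r).
change (RInt (h ((1 - t) * c + t * c')%C) 0 (2 * PI)
  < (1 - t) * RInt (h c) 0 (2 * PI) + t * RInt (h c') 0 (2 * PI)).
assert (Hc : forall c x, continuous (h c) x)
  by (intros; apply circle_integrand_continuous; assumption).
assert (E : (1 - t) * RInt (h c) 0 (2 * PI) + t * RInt (h c') 0 (2 * PI)
   = RInt (fun x => (1 - t) * h c x + t * h c' x) 0 (2 * PI)).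
{ symmetry. apply is_RInt_unique.
  apply (is_RInt_plus (V := R_NormedModule)); apply (is_RInt_scal (V := R_NormedModule));
  apply (RInt_correct (V := R_CompleteNormedModule)); apply ex_RInt_cont, Hc. }
rewrite E. pose proof PI_RGT_0.
apply RInt_lt; [lra| | |].
- intros x _. apply (continuous_plus (V := R_NormedModule));
  apply (continuous_scal_r (V := R_NormedModule)); apply Hc.
- intros x _. apply Hc.
- intros x _. unfold h, circle_integrand.
  set (p := f (circle_point z r x)).
  set (q := Cconj (circle_point z r x - z)).
  replace (p - ((1 - t) * c + t * c') * q)%C
    with ((1 - t) * (p - c * q) + t * (p - c' * q))%C by ring.
  assert (Hpq : (p - c * q)%C <> (p - c' * q)%C).
  { intros Heq. apply Hne.
    assert (Hz : ((c - c') * q = 0)%C).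
    { replace ((c - c') * q)%C with ((p - c' * q) - (p - c * q))%C by ring.
      rewrite Heq; ring. }
    assert (Hm : Cmod ((c - c') * q)%C = 0) by (rewrite Hz; apply Cmod_0).
    rewrite Cmod_mult in Hm. unfold q in Hm.
    rewrite circle_point_conj, Cmod_mult, Cmod_cos_sin_conj, Cmod_R, Rabs_pos_eq in Hm by lra.
    assert (Hcc : Cmod (c - c')%C = 0) by nra.
    apply Cmod_eq_0 in Hcc.
    replace c with ((c - c') + c')%C by ring. rewrite Hcc; ring. }
  pose proof (radial_strictly_convex F F_ge0 F_0 F_convex _ _ t Hpq Ht). nra.
Qed.

Lemma calF_lipschitz (F : R -> R)
  (F_ge0 : forall s, 0 <= s -> 0 <= F s) (F_0 : F 0 = 0)
  (F_convex : strictly_convex_nonneg F) (f : C -> C) (z : C) (r M N : R) :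
  (forall t, continuous (T := C_UniformSpace) (U := C_UniformSpace) f (circle_point z r t)) ->
  0 < r -> (forall t, Cmod (f (circle_point z r t)) <= M) ->
  forall c c', Cmod c <= N -> Cmod c' <= N ->
  Rabs (calF F f z r c - calF F f z r c')
    <= 2 * PI * (F (M + N * r + 1) * r * r) * Cmod (c - c')%C.
Proof.
intros Hf Hr HM c c' Hc Hc'.
set (h := circle_integrand F f z r).
assert (Hcont : forall c x, continuous (h c) x)
  by (intros; apply circle_integrand_continuous; assumption).
rewrite calF_minus by assumption. pose proof PI_RGT_0.
replace (2 * PI * (F (M + N * r + 1) * r * r) * Cmod (c - c')%C)
  with ((2 * PI - 0) * (F (M + N * r + 1) * (Cmod (c - c')%C * r) * r)) by ring.
apply abs_RInt_le_const; [lra| |].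
- apply ex_RInt_cont. intros x. apply (continuous_minus (V := R_NormedModule)); apply Hcont.
- intros x _. unfold h, circle_integrand.
  set (p := f (circle_point z r x)).
  set (q := Cconj (circle_point z r x - z)).
  assert (Hq : Cmod q = r).
  { unfold q. rewrite circle_point_conj, Cmod_mult, Cmod_cos_sin_conj, Cmod_R, Rabs_pos_eq; lra. }
  assert (Hb : forall c, Cmod c <= N -> Cmod (p - c * q)%C <= M + N * r).
  { intros d Hd. eapply Rle_trans; [apply Cmod_triangle|].
    rewrite Cmod_opp, Cmod_mult, Hq. specialize (HM x). fold p in HM. nra. }
  rewrite <- Rmult_minus_distr_r, Rabs_mult, (Rabs_pos_eq r) by lra.
  apply Rmult_le_compat_r; [lra|].
  eapply Rle_trans; [apply (radial_lipschitz F F_ge0 F_0 F_convex (M + N * r)); auto|].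
  replace (p - c * q - (p - c' * q))%C with (- ((c - c') * q))%C by ring.
  rewrite Cmod_opp, Cmod_mult, Hq. lra.
Qed.

(** * The second-order gap of the functional *)

(** A perturbation e common to u and u' changes the difference of the jets only
    by a term bilinear in u - u' and e: the linear part cancels. This is what makes
    the first-order error of f harmless. *)
Lemma jet2_perturb (g1 g2 : R) (w u u' e : C) :
  Rabs ((jet2 g1 g2 w (u + e)%C - jet2 g1 g2 w (u' + e)%C)
        - (jet2 g1 g2 w u - jet2 g1 g2 w u'))
  <= (2 * Rabs g1 + 4 * Rabs g2 * Cmod w ^ 2) * (Cmod (u - u')%C * Cmod e).
Proof.
replace ((jet2 g1 g2 w (u + e)%C - jet2 g1 g2 w (u' + e)%C)
        - (jet2 g1 g2 w u - jet2 g1 g2 w u'))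
  with (2 * (g1 * Cdot (u - u')%C e) + 4 * (g2 * (Cdot w e * Cdot w (u - u')%C))).
2:{ unfold jet2, Cdot. rewrite !Cmod_sqr.
    destruct w, u, u', e; simpl. ring. }
eapply Rle_trans; [apply Rabs_triang|].
rewrite !Rabs_mult, (Rabs_pos_eq 2), (Rabs_pos_eq 4) by lra.
rewrite Rmult_plus_distr_r. apply Rplus_le_compat.
- rewrite Rmult_assoc. apply Rmult_le_compat_l; [lra|].
  apply Rmult_le_compat_l; [apply Rabs_pos|apply Rabs_Cdot_le].
- rewrite !Rmult_assoc. apply Rmult_le_compat_l; [lra|].
  apply Rmult_le_compat_l; [apply Rabs_pos|].
  replace (Cmod w ^ 2 * (Cmod (u - u')%C * Cmod e))
    with ((Cmod w * Cmod e) * (Cmod w * Cmod (u - u')%C)) by ring.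
  apply Rmult_le_compat; try apply Rabs_pos; apply Rabs_Cdot_le.
Qed.

Lemma Cmod_rotations_le (a d : C) (t : R) :
  Cmod (a * (cos t, sin t) + d * (cos t, (- sin t)%R))%C <= Cmod a + Cmod d.
Proof.
eapply Rle_trans; [apply Cmod_triangle|].
rewrite !Cmod_mult, Cmod_cos_sin, Cmod_cos_sin_conj. lra.
Qed.

Lemma is_RInt_trig (k a b d e : R) :
  is_RInt (fun t => k + a * cos t + b * sin t
     + d * (cos t ^ 2 - sin t ^ 2) + e * (2 * sin t * cos t)) 0 (2 * PI) (2 * PI * k).
Proof.
set (P := fun t => k * t + a * sin t - b * cos t + d * (sin t * cos t) + e * sin t ^ 2).
replace (2 * PI * k) with (minus (P (2 * PI)) (P 0)).
2:{ unfold P, minus, plus, opp; simpl.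
    rewrite sin_2PI, cos_2PI, sin_0, cos_0. ring. }
apply (is_RInt_derive P).
- intros t _. unfold P. auto_derive; [trivial|]. ring.
- intros t _. apply (ex_derive_continuous (V := R_NormedModule) (fun t => k + a * cos t + b * sin t
     + d * (cos t ^ 2 - sin t ^ 2) + e * (2 * sin t * cos t))).
  auto_derive. trivial.
Qed.

(** Integral of the jet over the ellipse t |-> a e^(it) + d e^(-it): the linear
    terms average to 0, and |v|^2 and v^2 average to |a|^2 + |d|^2 and 2 a d. *)
Lemma is_RInt_jet2 (g1 g2 : R) (w a d : C) :
  is_RInt (fun t => jet2 g1 g2 w (a * (cos t, sin t) + d * (cos t, (- sin t)%R))%C)
    0 (2 * PI)
    (2 * PI * ((g1 + g2 * Cmod w ^ 2) * (Cmod a ^ 2 + Cmod d ^ 2)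
               + 2 * g2 * Re (Cconj w * Cconj w * (a * d))%C)).
Proof.
(* The ellipse is t |-> (p1, p2) cos t + (q1, q2) sin t; x and y are the scalar
   products of w with these two vectors. *)
set (p1 := fst a + fst d). set (q1 := snd d - snd a).
set (p2 := snd a + snd d). set (q2 := fst a - fst d).
set (x := fst w * p1 + snd w * p2). set (y := fst w * q1 + snd w * q2).
replace ((g1 + g2 * Cmod w ^ 2) * (Cmod a ^ 2 + Cmod d ^ 2)
               + 2 * g2 * Re (Cconj w * Cconj w * (a * d))%C)
  with (g1 * (p1 ^ 2 + q1 ^ 2 + p2 ^ 2 + q2 ^ 2) / 2 + g2 * (x ^ 2 + y ^ 2)).
2:{ rewrite !Cmod_sqr. unfold x, y, p1, p2, q1, q2. destruct w, a, d; simpl. field. }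
eapply is_RInt_ext; [|exact (is_RInt_trig
  (g1 * (p1 ^ 2 + q1 ^ 2 + p2 ^ 2 + q2 ^ 2) / 2 + g2 * (x ^ 2 + y ^ 2))
  (2 * g1 * x) (2 * g1 * y)
  (g1 * (p1 ^ 2 - q1 ^ 2 + p2 ^ 2 - q2 ^ 2) / 2 + g2 * (x ^ 2 - y ^ 2))
  (g1 * (p1 * q1 + p2 * q2) + 2 * g2 * (x * y)))].
intros t _.
assert (Hcs : cos t ^ 2 + sin t ^ 2 = 1).
{ pose proof (sin2_cos2 t) as H. unfold Rsqr in H. lra. }
unfold jet2, Cdot. rewrite Cmod_sqr.
replace (fst (a * (cos t, sin t) + d * (cos t, (- sin t)%R))%C)
  with (p1 * cos t + q1 * sin t) by (unfold p1, q1; simpl; ring).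
replace (snd (a * (cos t, sin t) + d * (cos t, (- sin t)%R))%C)
  with (p2 * cos t + q2 * sin t) by (unfold p2, q2; simpl; ring).
set (K := g1 * (p1 ^ 2 + q1 ^ 2 + p2 ^ 2 + q2 ^ 2) / 2 + g2 * (x ^ 2 + y ^ 2)).
rewrite <- (Rmult_1_r K), <- Hcs. unfold K, x, y.
match goal with |- ?l = ?r => change (@eq R l r) end. field.
Qed.

(** The average of the jet is a quadratic function of d, with critical point d'
    and leading coefficient g1 + g2 |w|^2. *)
Lemma jet2_mean_gap (g1 g2 : R) (w a d d' : C) :
  ((g1 + g2 * Cmod w ^ 2)%R * d' = - (g2 * (w * w * Cconj a)))%C ->
  ((g1 + g2 * Cmod w ^ 2) * (Cmod a ^ 2 + Cmod d ^ 2)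
     + 2 * g2 * Re (Cconj w * Cconj w * (a * d))%C)
  - ((g1 + g2 * Cmod w ^ 2) * (Cmod a ^ 2 + Cmod d' ^ 2)
     + 2 * g2 * Re (Cconj w * Cconj w * (a * d'))%C)
  = (g1 + g2 * Cmod w ^ 2) * Cmod (d - d')%C ^ 2.
Proof.
intros H. set (k := g1 + g2 * Cmod w ^ 2) in *.
assert (Hd : forall b : C, g2 * Re (Cconj w * Cconj w * (a * b))%C
   = - (k * (fst d' * fst b + snd d' * snd b))).
{ intros b.
  assert (H1 : k * fst d' = - (g2 * fst (w * w * Cconj a)%C)).
  { apply (f_equal fst) in H. simpl in H |- *. lra. }
  assert (H2 : k * snd d' = - (g2 * snd (w * w * Cconj a)%C)).
  { apply (f_equal snd) in H. simpl in H |- *. lra. }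
  replace (k * (fst d' * fst b + snd d' * snd b))
    with ((k * fst d') * fst b + (k * snd d') * snd b) by ring.
  rewrite H1, H2. destruct w, a, b; simpl. ring. }
rewrite !Rmult_assoc, !Hd, !Cmod_sqr.
destruct d, d'; simpl. ring.
Qed.

(** Real differentiability in complex form:
    f(z + h) = f(z) + a h + b conj(h) + o(|h|) as h -> 0, so that a and b are the
    z- and conj(z)-derivatives of f at z. *)
Definition wirtinger_expansion (f : C -> C) (z a b : C) : Prop :=
  forall eta, 0 < eta -> exists d, 0 < d /\ forall h, Cmod h < d ->
    Cmod (f (z + h) - f z - (a * h + b * Cconj h))%C <= eta * Cmod h.

(** On the circle |c - c0| = e, the value of calF exceeds that at c0 by at least
    2 pi r^3 (k e^2 - eta Z), for every eta in (0, 1] and all r small in terms of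
    eta; Z does not depend on eta and r. *)
Lemma calF_gap (F : R -> R)
  (F_ge0 : forall s, 0 <= s -> 0 <= F s) (F_0 : F 0 = 0)
  (F_convex : strictly_convex_nonneg F) (F_C2 : C2_pos F)
  (f : C -> C) (z a b c0 : C) :
  let w := f z in
  let s := Cmod w in
  let g1 := Derive F s / (2 * s) in
  let g2 := (Derive_n F 2 s - Derive F s / s) / (4 * s ^ 2) in
  let k := g1 + g2 * s ^ 2 in
  w <> 0%C -> 0 < k ->
  (k * (b - c0) = - (g2 * (w * w * Cconj a)))%C ->
  wirtinger_expansion f z a b ->
  forall e, 0 < e -> exists d, 0 < d /\ forall r, 0 < r < d ->
    (forall t, continuous (T := C_UniformSpace) (U := C_UniformSpace) f (circle_point z r t)) ->
    forall c, Cmod (c - c0)%C = e -> calF F f z r c0 < calF F f z r c.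
Proof.
intros w s g1 g2 k Hw Hk Hc0 Hf e He.
set (Q := 2 * Rabs g1 + 4 * Rabs g2 * s ^ 2).
set (M := Cmod a + Cmod b + Cmod c0 + e + 1).
assert (HQ : 0 <= Q).
{ unfold Q. pose proof (Rabs_pos g1). pose proof (Rabs_pos g2).
  pose proof (pow2_ge_0 s). nra. }
assert (HM : 1 <= M).
{ unfold M. pose proof (Cmod_ge_0 a). pose proof (Cmod_ge_0 b). pose proof (Cmod_ge_0 c0). lra. }
set (Z := Q * e + 2 * M ^ 2).
assert (HZ : 0 < Z) by (unfold Z; nra).
(* This choice gives eta Z < k e^2: the quadratic gap dominates the errors. *)
set (eta := Rmin 1 (k * e ^ 2 / (2 * Z))).
assert (Heta : 0 < eta).
{ apply Rmin_pos; [lra|]. apply Rdiv_lt_0_compat; [|lra].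
  apply Rmult_lt_0_compat; [lra|apply pow_lt, He]. }
assert (Heta1 : eta <= 1) by apply Rmin_l.
assert (HetaZ : eta * Z < k * e ^ 2).
{ assert (Hr : eta <= k * e ^ 2 / (2 * Z)) by apply Rmin_r.
  assert (eta * Z <= k * e ^ 2 / (2 * Z) * Z) by (apply Rmult_le_compat_r; lra).
  replace (k * e ^ 2 / (2 * Z) * Z) with (k * e ^ 2 / 2) in H by (field; lra).
  assert (0 < k * e ^ 2) by (apply Rmult_lt_0_compat; [lra|apply pow_lt, He]). lra. }
destruct (Hf eta Heta) as [d1 [Hd1 Hfd]].
destruct (radial_taylor F F_C2 w Hw eta Heta) as [d2 [Hd2 HT]].
fold s in HT. fold g1 g2 in HT.
exists (Rmin d1 (d2 / M)). split.
{ apply Rmin_pos; [lra|]. apply Rdiv_lt_0_compat; lra. }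
intros r [Hr Hrd] Hcont c Hc.
assert (Hr1 : r < d1) by (eapply Rlt_le_trans; [exact Hrd|apply Rmin_l]).
assert (Hr2 : r * M < d2).
{ apply (proj2 (Rlt_div_r r d2 M ltac:(lra))).
  eapply Rlt_le_trans; [exact Hrd|apply Rmin_r]. }
set (h := circle_integrand F f z r).
assert (Hh : forall c x, continuous (h c) x)
  by (intros; apply circle_integrand_continuous; assumption).
(* f - c conj(zeta - z) = w + u c t + er t, with u of order r and er independent
   of c and of order eta r *)
set (u := fun c t => ((r * a) * (cos t, sin t) + (r * (b - c)) * (cos t, (- sin t)%R))%C).
set (er := fun t => (f (circle_point z r t) - w - (a * (r * (cos t, sin t))
   + b * Cconj (r * (cos t, sin t))))%C).
assert (Hpt : forall t, Cmod (r * (cos t, sin t))%C = r).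
{ intros t. rewrite Cmod_mult, Cmod_cos_sin, Cmod_R, Rabs_pos_eq; lra. }
assert (Her : forall t, Cmod (er t) <= eta * r).
{ intros t. unfold er, circle_point.
  pose proof (Hfd (r * (cos t, sin t))%C) as H. rewrite Hpt in H. exact (H Hr1). }
assert (Hdec : forall c t, (f (circle_point z r t) - c * Cconj (circle_point z r t - z)
   = w + (u c t + er t))%C).
{ intros c' t. unfold u, er. rewrite circle_point_conj.
  apply injective_projections; simpl; ring. }
assert (Hu : forall c', Cmod (c' - c0)%C <= e -> forall t,
  Cmod (u c' t + er t)%C <= r * M).
{ intros c' Hc' t. eapply Rle_trans; [apply Cmod_triangle|].
  assert (Hut : Cmod (u c' t) <= r * (Cmod a + Cmod b + Cmod c0 + e)).
  { unfold u. eapply Rle_trans; [apply Cmod_rotations_le|].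
    rewrite !Cmod_mult, !Cmod_R, !Rabs_pos_eq by lra.
    assert (Cmod (b - c')%C <= Cmod b + Cmod c0 + e).
    { replace (b - c')%C with (b + (- c0 + - (c' - c0)))%C by ring.
      eapply Rle_trans; [apply Cmod_triangle|].
      pose proof (Cmod_triangle (- c0) (- (c' - c0))%C) as H.
      rewrite !Cmod_opp in H. lra. }
    nra. }
  specialize (Her t). unfold M. nra. }
assert (Hlow : forall t, (jet2 g1 g2 w (u c t) - jet2 g1 g2 w (u c0 t) - eta * Z * r ^ 2) * r
   <= h c t - h c0 t).
{ intros t. unfold h, circle_integrand. rewrite !Hdec, <- Rmult_minus_distr_r.
  apply Rmult_le_compat_r; [lra|].
  assert (Huc := Hu c ltac:(lra) t).
  assert (Huc0 := Hu c0 ltac:(replace (c0 - c0)%C with (RtoC 0) by ring;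
    rewrite Cmod_0; lra) t).
  assert (T1 := HT (u c t + er t)%C ltac:(lra)).
  assert (T0 := HT (u c0 t + er t)%C ltac:(lra)).
  assert (Hsq : forall v, Cmod v <= r * M -> eta * Cmod v ^ 2 <= eta * (M ^ 2 * r ^ 2)).
  { intros v Hv. apply Rmult_le_compat_l; [lra|].
    replace (M ^ 2 * r ^ 2) with ((r * M) ^ 2) by ring.
    apply pow_incr. split; [apply Cmod_ge_0|exact Hv]. }
  pose proof (Hsq _ Huc) as S1. pose proof (Hsq _ Huc0) as S0.
  pose proof (jet2_perturb g1 g2 w (u c t) (u c0 t) (er t)) as HP.
  fold s in HP. fold Q in HP.
  assert (Hdu : Cmod (u c t - u c0 t)%C = r * e).
  { replace (u c t - u c0 t)%C with (- (r * ((c - c0) * (cos t, (- sin t)%R))))%C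
      by (unfold u; ring).
    rewrite Cmod_opp, !Cmod_mult, Hc, Cmod_cos_sin_conj, Cmod_R, Rabs_pos_eq; lra. }
  rewrite Hdu in HP.
  assert (HP' : Q * (r * e * Cmod (er t)) <= eta * (Q * e) * r ^ 2).
  { replace (eta * (Q * e) * r ^ 2) with (Q * (r * e * (eta * r))) by ring.
    apply Rmult_le_compat_l; [lra|]. apply Rmult_le_compat_l; [nra|apply Her]. }
  apply Rabs_le_between in T1. apply Rabs_le_between in T0. apply Rabs_le_between in HP.
  unfold Z. lra. }
assert (HI : is_RInt (fun t => (jet2 g1 g2 w (u c t) - jet2 g1 g2 w (u c0 t)
   - eta * Z * r ^ 2) * r) 0 (2 * PI) (2 * PI * (k * e ^ 2 - eta * Z) * r ^ 2 * r)).
{ pose proof (is_RInt_jet2 g1 g2 w (r * a)%C (r * (b - c))%C) as I1.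
  pose proof (is_RInt_jet2 g1 g2 w (r * a)%C (r * (b - c0))%C) as I0.
  pose proof (jet2_mean_gap g1 g2 w (r * a)%C (r * (b - c))%C (r * (b - c0))%C) as Hg.
  fold s in I1, I0, Hg. fold k in I1, I0, Hg.
  assert (Hq : (k * (r * (b - c0)) = - (g2 * (w * w * Cconj (r * a))))%C).
  { replace (k * (r * (b - c0)))%C with (r * (k * (b - c0)))%C by ring.
    rewrite Hc0. apply injective_projections; simpl; ring. }
  specialize (Hg Hq).
  replace (r * (b - c) - r * (b - c0))%C with (- (r * (c - c0)))%C in Hg by ring.
  rewrite Cmod_opp, (Cmod_mult r (c - c0)%C), Hc, Cmod_R, Rabs_pos_eq in Hg by lra.
  set (X1 := k * _ + _) in I1, Hg. set (X0 := k * _ + _) in I0, Hg.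
  clearbody X1 X0.
  pose proof (is_RInt_const (V := R_NormedModule) 0 (2 * PI) (eta * Z * r ^ 2)) as IC.
  pose proof (is_RInt_scal (V := R_NormedModule) _ _ _ r _
    (is_RInt_minus (V := R_NormedModule) _ _ _ _ _ _
     (is_RInt_minus (V := R_NormedModule) _ _ _ _ _ _ I1 I0) IC)) as I.
  unfold scal, minus, plus, opp in I; simpl in I; unfold mult in I; simpl in I.
  eapply is_RInt_ext; [|refine (eq_ind _ (is_RInt _ _ _) I _ _)].
  - intros t _. unfold u. simpl. ring.
  - replace X1 with (X0 + k * (r * e) ^ 2) by lra.
    match goal with |- ?l = ?r => change (@eq R l r) end. ring. }
pose proof PI_RGT_0.
pose proof (calF_minus F F_ge0 F_0 F_convex f z r c c0 Hcont) as E.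
assert (HL : RInt (fun t => (jet2 g1 g2 w (u c t) - jet2 g1 g2 w (u c0 t)
   - eta * Z * r ^ 2) * r) 0 (2 * PI) <= calF F f z r c - calF F f z r c0).
{ rewrite E. apply RInt_le; [lra| | |intros; apply Hlow].
  - eexists; exact HI.
  - apply ex_RInt_cont. intros x. apply (continuous_minus (V := R_NormedModule)); apply Hh. }
rewrite (is_RInt_unique _ _ _ _ HI) in HL.
assert (0 < 2 * PI * (k * e ^ 2 - eta * Z) * r ^ 2 * r).
{ apply Rmult_lt_0_compat; [|lra]. apply Rmult_lt_0_compat; [|apply pow_lt; lra].
  apply Rmult_lt_0_compat; lra. }
lra.
Qed.

(** * Wirtinger derivatives and the limit of the minimum points *)

Lemma norm_C_R (h : C) : norm (V := C_R_NormedModule) h = Cmod h.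
Proof.
change (sqrt (Rabs (fst h) ^ 2 + Rabs (snd h) ^ 2) = sqrt (fst h ^ 2 + snd h ^ 2)).
rewrite !pow2_abs. reflexivity.
Qed.

Lemma real_differentiable_expansion (f : C -> C) (z : C) :
  real_differentiable f z -> exists a b, wirtinger_expansion f z a b.
Proof.
intros [l [Hl Hd]].
assert (Hz : is_filter_lim (locally (T := C_R_NormedModule) z) z).
{ intros P HP; exact HP. }
specialize (Hd z Hz).
set (u := l (1, 0) : C). set (v := l (0, 1) : C).
exists (((fst u + snd v) / 2, (snd u - fst v) / 2)).
exists (((fst u - snd v) / 2, (snd u + fst v) / 2)).
assert (Hlin : forall h : C, l h = (fst h * u + snd h * v)%C).
{ intros h.
  assert (E : h = plus (G := C_R_NormedModule)
     (scal (fst h : R_AbsRing) ((1, 0) : C_R_NormedModule))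
     (scal (snd h : R_AbsRing) ((0, 1) : C_R_NormedModule))).
  { destruct h as [h1 h2].
    apply injective_projections; unfold plus, scal; simpl; unfold plus, scal; simpl;
    unfold mult; simpl; ring. }
  rewrite E at 1. rewrite (linear_plus _ Hl), !(linear_scal _ Hl).
  fold u v. destruct u, v.
  apply injective_projections; unfold plus, scal; simpl; unfold plus, scal; simpl;
    unfold mult; simpl; ring. }
intros eta Heta. destruct (Hd (mkposreal _ Heta)) as [d Hdd].
exists d. split; [apply cond_pos|]. intros h Hh.
specialize (Hdd (z + h)%C).
assert (Hb : ball (M := C_R_NormedModule) z d (z + h)%C).
{ apply (ball_C z (z + h)%C d). replace (z + h - z)%C with h by ring. exact Hh. }
specialize (Hdd Hb). rewrite !norm_C_R in Hdd. simpl pos in Hdd.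
change (minus (z + h)%C z) with (z + h - z)%C in Hdd.
replace (z + h - z)%C with h in Hdd by ring.
rewrite Hlin in Hdd.
change (Cmod (f (z + h)%C - f z - (fst h * u + snd h * v))%C <= eta * Cmod h) in Hdd.
eapply Rle_trans; [|exact Hdd]. right. f_equal.
destruct h, u, v. apply injective_projections; simpl; field.
Qed.

Lemma wirtinger_expansion_conj (f : C -> C) (z a b : C) :
  wirtinger_expansion f z a b ->
  wirtinger_expansion (fun w => Cconj (f w)) z (Cconj b) (Cconj a).
Proof.
intros H eta Heta. destruct (H eta Heta) as [d [Hd Hh]].
exists d; split; [exact Hd|]. intros h Hhd. specialize (Hh h Hhd).
rewrite <- Cmod_conj in Hh.
eapply Rle_trans; [|exact Hh]. right. f_equal.
apply injective_projections; simpl; ring.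
Qed.

(** Directional derivative at z along a unit vector v. *)
Lemma wirtinger_expansion_dir (f : C -> C) (z a b v : C) :
  Cmod v = 1 -> wirtinger_expansion f z a b ->
  is_derive (fun x : R => fst (f (z + x * v)%C)) 0 (fst (a * v + b * Cconj v)%C) /\
  is_derive (fun x : R => snd (f (z + x * v)%C)) 0 (snd (a * v + b * Cconj v)%C).
Proof.
intros Hv H.
assert (Hgen : forall eta, 0 < eta -> exists d : posreal, forall x : R, x <> 0 ->
  Rabs x < d ->
  Cmod ((f (z + x * v) - f z) / x - (a * v + b * Cconj v))%C < eta).
{ intros eta Heta. destruct (H (eta / 2) ltac:(lra)) as [d [Hd Hh]].
  exists (mkposreal d Hd). intros x Hx Hxd. simpl in Hxd.
  assert (Hxv : Cmod (x * v)%C = Rabs x) by (rewrite Cmod_mult, Cmod_R, Hv; ring).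
  specialize (Hh (x * v)%C). rewrite Hxv in Hh. specialize (Hh Hxd).
  assert (HxC : RtoC x <> 0%C) by (intros E; apply Hx; injection E; auto).
  replace ((f (z + x * v) - f z) / x - (a * v + b * Cconj v))%C
    with ((f (z + x * v) - f z - (a * (x * v) + b * Cconj (x * v))) / x)%C.
  2:{ rewrite Cmult_conj. replace (Cconj x) with (RtoC x)
        by (apply injective_projections; simpl; ring). field. exact HxC. }
  rewrite Cmod_div, Cmod_R by exact HxC.
  apply Rabs_pos_lt in Hx.
  apply Rle_lt_trans with (eta / 2); [|lra].
  apply Rle_div_l; lra. }
split; apply is_derive_Reals; intros eta Heta;
  destruct (Hgen eta Heta) as [d Hd]; exists d; intros x Hx Hxd;
  specialize (Hd x Hx Hxd); rewrite Rplus_0_l;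
  replace (z + 0 * v)%C with z by (apply injective_projections; simpl; ring);
  (eapply Rle_lt_trans; [|exact Hd]).
- eapply Rle_trans; [|apply Rabs_fst_le]. right. f_equal.
  simpl. field. exact Hx.
- eapply Rle_trans; [|apply Rabs_snd_le]. right. f_equal.
  simpl. field. exact Hx.
Qed.

Lemma Derive_shift (g : R -> R) (x0 l : R) :
  is_derive (fun x => g (x0 + x)) 0 l -> Derive g x0 = l.
Proof.
intros H. apply is_derive_unique.
apply (is_derive_ext (fun x => g (x0 + (x - x0)))).
{ intros t. f_equal. simpl. ring. }
assert (H2 : is_derive (fun x => x - x0) x0 1) by (auto_derive; [trivial|ring]).
replace 0 with (x0 - x0) in H by ring.
pose proof (is_derive_comp (fun x => g (x0 + x)) (fun x => x - x0) x0 l 1 H H2) as H3.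
replace l with (scal (V := R_NormedModule) 1 l) by (apply (scal_one (V := R_NormedModule))).
exact H3.
Qed.

Lemma Dzbar_expansion (f : C -> C) (z a b : C) :
  wirtinger_expansion f z a b -> Dzbar f z = b.
Proof.
intros H.
assert (H1 : Cmod (1, 0) = 1).
{ transitivity (sqrt 1); [unfold Cmod; simpl; f_equal; ring|apply sqrt_1]. }
assert (H2 : Cmod (0, 1) = 1).
{ transitivity (sqrt 1); [unfold Cmod; simpl; f_equal; ring|apply sqrt_1]. }
destruct (wirtinger_expansion_dir f z a b (1, 0) H1 H) as [X1 X2].
destruct (wirtinger_expansion_dir f z a b (0, 1) H2 H) as [Y1 Y2].
assert (Px : partial_x f z = (a + b)%C).
{ unfold partial_x. apply injective_projections; simpl fst; simpl snd.
  - transitivity (fst (a * (1, 0) + b * Cconj (1, 0))%C); [apply Derive_shift|simpl; ring].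
    eapply is_derive_ext; [|exact X1]. intros t. simpl. unfold Re. do 2 f_equal.
    apply injective_projections; simpl; unfold Re, Im; ring.
  - transitivity (snd (a * (1, 0) + b * Cconj (1, 0))%C); [apply Derive_shift|simpl; ring].
    eapply is_derive_ext; [|exact X2]. intros t. simpl. unfold Im. do 2 f_equal.
    apply injective_projections; simpl; unfold Re, Im; ring. }
assert (Py : partial_y f z = (Ci * (a - b))%C).
{ unfold partial_y. apply injective_projections; simpl fst; simpl snd.
  - transitivity (fst (a * (0, 1) + b * Cconj (0, 1))%C); [apply Derive_shift|simpl; ring].
    eapply is_derive_ext; [|exact Y1]. intros t. simpl. unfold Re. do 2 f_equal.
    apply injective_projections; simpl; unfold Re, Im; ring.
  - transitivity (snd (a * (0, 1) + b * Cconj (0, 1))%C); [apply Derive_shift|simpl; ring].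
    eapply is_derive_ext; [|exact Y2]. intros t. simpl. unfold Im. do 2 f_equal.
    apply injective_projections; simpl; unfold Re, Im; ring. }
unfold Dzbar. rewrite Px, Py.
apply injective_projections; simpl; field.
Qed.

(** The minimum points converge at every z with f(z) <> 0, whether or not the
    equation holds there. *)
Lemma cF_limit (F : R -> R)
  (F_ge0 : forall s, 0 <= s -> 0 <= F s) (F_0 : F 0 = 0)
  (F_convex : strictly_convex_nonneg F) (F_C2 : C2_pos F)
  (Omega : C -> Prop) (Omega_open : open Omega) (f : C -> C)
  (f_diff : forall z, Omega z -> real_differentiable f z)
  (z a b : C) :
  let L := Lambda F (Cmod (f z)) in
  Omega z -> f z <> 0%C -> 0 < L -> wirtinger_expansion f z a b ->
  filterlim (fun r : R => cF F f r z) (at_right 0)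
    (locally ((b + (L - 1) / (L + 1) * (f z / Cconj (f z)) * Cconj a)%C : C)).
Proof.
intros L Hz Hfz HL Hexp.
set (c0 := (b + (L - 1) / (L + 1) * (f z / Cconj (f z)) * Cconj a)%C).
set (s := Cmod (f z)).
assert (Hs : 0 < s) by (apply Cmod_gt_0, Hfz).
set (g1 := Derive F s / (2 * s)).
set (g2 := (Derive_n F 2 s - Derive F s / s) / (4 * s ^ 2)).
set (k := g1 + g2 * s ^ 2).
assert (HF' : 0 < Derive F s).
{ apply Derive_convex_pos; auto. apply F_C2, Hs. }
assert (Hk : k = Derive F s / s * (L + 1) / 4).
{ unfold k, g1, g2, L, Lambda. fold s. field. lra. }
assert (Hg : g2 * s ^ 2 = Derive F s / s * (L - 1) / 4).
{ unfold g2, L, Lambda. fold s. field. lra. }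
assert (Hk0 : 0 < k).
{ rewrite Hk. pose proof (Rdiv_lt_0_compat _ _ HF' Hs).
  apply Rdiv_lt_0_compat; [|lra]. apply Rmult_lt_0_compat; lra. }
(* b - c0 is the critical point of the averaged second-order expansion. *)
assert (Hcrit : (k * (b - c0) = - (g2 * (f z * f z * Cconj a)))%C).
{ assert (Hc : Cconj (f z) <> 0%C).
  { intros E. apply Hfz. rewrite <- (Cconj_conj (f z)), E.
    apply injective_projections; simpl; ring. }
  assert (H1 : (k * ((L - 1) / (L + 1)) = g2 * s ^ 2)%R).
  { rewrite Hk, Hg. field. split; lra. }
  assert (H2 : (RtoC (s ^ 2) * (f z / Cconj (f z)) = f z * f z)%C).
  { unfold s. rewrite Cmod2_conj. field. exact Hc. }
  unfold c0.
  replace (k * (b - (b + (L - 1) / (L + 1) * (f z / Cconj (f z)) * Cconj a)))%C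
    with (- (RtoC (k * ((L - 1) / (L + 1))) * (f z / Cconj (f z)) * Cconj a))%C.
  - rewrite H1, RtoC_mult, <- H2. ring.
  - rewrite RtoC_mult, RtoC_div, RtoC_minus, RtoC_plus by lra. ring. }
(* On every small enough circle, calF has its only minimum within eps of c0. *)
apply filterlim_locally. intros eps.
destruct (calF_gap F F_ge0 F_0 F_convex F_C2 f z a b c0 Hfz Hk0 Hcrit Hexp eps
  (cond_pos eps)) as [d1 [Hd1 Hgap]].
destruct (Omega_open z Hz) as [d2 Hd2].
destruct (Hexp 1 Rlt_0_1) as [d3 [Hd3 Hf1]].
assert (Hd : 0 < Rmin d1 (Rmin d2 (Rmin d3 1))).
{ repeat apply Rmin_pos; try lra. apply cond_pos. }
exists (mkposreal _ Hd). intros r Hr Hr0. simpl in Hr.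
change (Rabs (r - 0) < Rmin d1 (Rmin d2 (Rmin d3 1))) in Hr.
rewrite Rminus_0_r, Rabs_pos_eq in Hr by lra.
apply Rmin_Rgt_l in Hr. destruct Hr as [Hr1 Hr].
apply Rmin_Rgt_l in Hr. destruct Hr as [Hr2 Hr].
apply Rmin_Rgt_l in Hr. destruct Hr as [Hr3 Hr4].
assert (Hpt : forall t, Cmod (r * (cos t, sin t))%C = r).
{ intros t. rewrite Cmod_mult, Cmod_cos_sin, Cmod_R, Rabs_pos_eq; lra. }
assert (Hcont : forall t,
  continuous (T := C_UniformSpace) (U := C_UniformSpace) f (circle_point z r t)).
{ intros t. apply (filterdiff_continuous (K := R_AbsRing) (U := C_R_NormedModule)
    (V := C_R_NormedModule) f). apply f_diff. apply Hd2.
  apply (ball_C z). unfold circle_point.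
  replace (z + r * (cos t, sin t) - z)%C with (r * (cos t, sin t))%C by ring.
  rewrite Hpt. lra. }
assert (Hbd : forall t, Cmod (f (circle_point z r t)) <= s + Cmod a + Cmod b + 1).
{ intros t. unfold circle_point. set (h := (r * (cos t, sin t))%C).
  assert (Hh : Cmod h = r) by apply Hpt.
  specialize (Hf1 h ltac:(lra)).
  replace (f (z + h)%C) with ((f (z + h) - f z - (a * h + b * Cconj h))
    + (f z + (a * h + b * Cconj h)))%C by ring.
  eapply Rle_trans; [apply Cmod_triangle|].
  pose proof (Cmod_triangle (f z) (a * h + b * Cconj h)).
  pose proof (Cmod_triangle (a * h) (b * Cconj h)).
  rewrite !Cmod_mult, Cmod_conj, Hh in H0. fold s in H.
  pose proof (Cmod_ge_0 a). pose proof (Cmod_ge_0 b). nra. }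
destruct (strictly_convex_unique_min (calF F f z r) c0 eps
  (2 * PI * (F (s + Cmod a + Cmod b + 1 + (Cmod c0 + 2 * eps) * r + 1) * r * r))
  (cond_pos eps)) as [m [Hm [Hmin Huniq]]].
- intros c c' t. apply calF_strictly_convex; assumption.
- assert (Hsq : forall c, in_square c0 eps c -> Cmod c <= Cmod c0 + 2 * eps).
  { intros c [E1 E2]. replace c with (c0 + (c - c0))%C by ring.
    eapply Rle_trans; [apply Cmod_triangle|].
    pose proof (Cmod_le_Rabs (c - c0)%C) as H.
    change (fst (c - c0)%C) with (fst c - fst c0) in H.
    change (snd (c - c0)%C) with (snd c - snd c0) in H. lra. }
  intros c c' Hc Hc'. apply calF_lipschitz; auto.
- apply Hgap; [lra|exact Hcont].
- assert (E : cF F f r z = m).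
  { apply (iota_unique (V := C_R_CompleteNormedModule)); assumption. }
  rewrite E. apply (ball_C c0 m eps Hm).
Qed.

Theorem theorem1p2 (F : R -> R)
  (F_ge0 : forall s : R, 0 <= s -> 0 <= F s)
  (F_C1 : C1_nonneg F)
  (F_C2 : C2_pos F)
  (F_convex : strictly_convex_nonneg F)
  (F_0 : F 0 = 0)
  (F'_0 : is_derive_nonneg F 0 0)
  (Lm Lp : R)
  (Lm_gt0 : 0 < Lm)
  (Lm_le_Lp : Lm <= Lp)
  (Lambda_bounds : forall s : R, 0 < s -> Lm <= Lambda F s <= Lp)
  (Omega : C -> Prop)
  (Omega_open : open Omega)
  (f : C -> C)
  (f_diff : forall z : C, Omega z -> real_differentiable f z) :
  (forall z : C, Omega z -> f z <> 0%C ->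
     filterlim (fun r : R => cF F f r z) (at_right 0) (locally (0%C : C)))
  <->
  (forall z : C, Omega z -> f z <> 0%C ->
     (Dzbar f z
      + (Lambda F (Cmod (f z)) - 1) / (Lambda F (Cmod (f z)) + 1)
        * (f z / Cconj (f z)) * Dzbar (fun w => Cconj (f w)) z)%C = 0%C).
Proof.
assert (Hlim : forall z, Omega z -> f z <> 0%C ->
  filterlim (fun r : R => cF F f r z) (at_right 0)
   (locally ((Dzbar f z
      + (Lambda F (Cmod (f z)) - 1) / (Lambda F (Cmod (f z)) + 1)
        * (f z / Cconj (f z)) * Dzbar (fun w => Cconj (f w)) z)%C : C))).
{ intros z Hz Hfz.
  destruct (real_differentiable_expansion f z (f_diff z Hz)) as [a [b H]].
  rewrite (Dzbar_expansion _ _ _ _ H),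
    (Dzbar_expansion _ _ _ _ (wirtinger_expansion_conj _ _ _ _ H)).
  apply (cF_limit F F_ge0 F_0 F_convex F_C2 Omega Omega_open f f_diff z a b Hz Hfz);
    [|exact H].
  apply Rlt_le_trans with Lm; [exact Lm_gt0|]. apply Lambda_bounds, Cmod_gt_0, Hfz. }
split; intros H z Hz Hfz.
- apply (filterlim_locally_unique (V := C_R_NormedModule) (F := at_right 0)
    (fun r : R => cF F f r z)); [apply Hlim|apply H]; assumption.
- rewrite <- (H z Hz Hfz). apply Hlim; assumption.
Qed.
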